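(* Let $\alpha\in(0,1)$, let $T\colon X\rightrightarrows X$ be a union $\alpha$-averaged nonexpansive operator, with a fixed representation $T(x)=\{T_i(x):i\in\varphi(x)\}$, let $x^*\in\mathbf{Fix}\,T$, and let $(\lambda_n)_{n\in\mathbb{N}}$ be a sequence in $(0,1/\alpha]$ with $\liminf_{n\to\infty}\lambda_n(1/\alpha-\lambda_n)>0$. Denote $r:=r(x^*;T)\in(0,+\infty]$ and consider $(x_n)_{n\in\mathbb{N}}$ with $x_0\in\operatorname{int}\mathbb{B}(x^*;r)$ satisfying $$\forall n\in\mathbb{N},\quad x_{n+1}\in(1-\lambda_n)x_n+\lambda_nT(x_n).$$ Then $(x_n)_{n\in\mathbb{N}}$ converges to a point $\overline{x}\in\operatorname{Fix}T\cap\mathbb{B}(x^*;r)$.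
   Context: $X$ is a real finite-dimensional Hilbert space with norm $\|\cdot\|$. A single-valued $S\colon X\to X$ is $\alpha$-averaged nonexpansive if $\alpha\in(0,1)$ and $\|Sx-Sy\|^2+\frac{1-\alpha}{\alpha}\|(\operatorname{Id}-S)x-(\operatorname{Id}-S)y\|^2\le\|x-y\|^2$ for all $x,y\in X$. A set-valued map $\varphi\colon X\rightrightarrows I$ is outer semicontinuous (osc) if, whenever $x_n\to\bar x$ and $i_n\to i$ with $i_n\in\varphi(x_n)$, one has $i\in\varphi(\bar x)$ (finite sets carry the discrete topology). $T\colon X\rightrightarrows X$ is union $\alpha$-averaged nonexpansive if $T(x)=\{T_i(x):i\in\varphi(x)\}$ for all $x\in X$, where $I$ is a finite index set, each $T_i\colon X\to X$ is $\alpha$-averaged nonexpansive, and $\varphi\colon X\rightrightarrows I$ is osc with nonempty values; such a representation is fixed. $\operatorname{Fix}T:=\{x:x\in T(x)\}$ and $\mathbf{Fix}\,T:=\{x:T(x)=\{x\}\}$. $\mathbb{B}(x;\delta)$ is the closed ball of center $x$ and radius $\delta$ (all of $X$ if $\delta=+\infty$). The radius of attraction (with respect to the fixed representation) is $r(x^*;T):=\sup\{\delta>0:\forall x\in\mathbb{B}(x^*;\delta),\ \varphi(x)\subseteq\varphi(x^* )\}$; it always lies in $(0,+\infty]$. *)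

(* Defs.v *)
From HB Require Import structures.
From mathcomp Require Export all_boot all_order all_algebra.
From mathcomp Require Export sesquilinear.
From mathcomp Require Export all_classical all_reals all_analysis.
Export Order.TTheory GRing.Theory Num.Theory.
Export numFieldNormedType.Exports.

Set Implicit Arguments.
Unset Strict Implicit.
Unset Printing Implicit Defensive.

Local Open Scope classical_set_scope.
Local Open Scope ring_scope.

(* Finite-dimensional normed spaces.  A finite-dimensional real Hilbert space
   is such a space together with a dot product [dot] inducing the norm. *)
#[short(type="normedVectType")]
HB.structure Definition NormedVector (R : realType) :=
  {V of NormedModule R V & Vector R V}.

Definition hilbert_norm (R : realType) (X : normedVectType R)
    (dot : {dot X for idfun}) : Prop :=
  forall x, `|x| ^+ 2 = dot x x.

Definition averaged_nonexpansive (R : realType) (X : normedModType R)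
    (alpha : R) (S : X -> X) : Prop :=
  [/\ 0 < alpha, alpha < 1 &
    forall x y, `|S x - S y| ^+ 2
      + (1 - alpha) / alpha * `|(x - S x) - (y - S y)| ^+ 2 <= `|x - y| ^+ 2].

Definition outer_semicontinuous (X Y : topologicalType) (phi : X -> set Y)
    : Prop :=
  forall (x_ : nat -> X) (y_ : nat -> Y) (x : X) (y : Y),
    x_ @ \oo --> x -> y_ @ \oo --> y ->
    (forall n, phi (x_ n) (y_ n)) -> phi x y.

Record union_averaged_repr (R : realType) (X : normedModType R) (alpha : R)
    (T : X -> set X) (I : finType) (T_ : I -> X -> X) (phi : X -> set I)
    : Prop := {
  uar_averaged : forall i, averaged_nonexpansive alpha (T_ i);
  uar_osc : @outer_semicontinuous X (discrete_topology I) phi;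
  uar_nonempty : forall x, phi x !=set0;
  uar_eq : forall x, T x = [set T_ i x | i in phi x] }.

Definition Fix (X : Type) (T : X -> set X) : set X := [set x | T x x].

Definition strong_Fix (X : Type) (T : X -> set X) : set X :=
  [set x | T x = [set x]].

(* The library's [closed_ball] only takes finite radii. *)
Definition eclosed_ball (R : realType) (X : normedModType R) (x : X)
    (delta : \bar R) : set X :=
  [set y | (`|x - y|%:E <= delta)%E].

Definition attraction_radius (R : realType) (X : normedModType R) (I : Type)
    (phi : X -> set I) (xstar : X) : \bar R :=
  ereal_sup [set delta | (0 < delta)%E /\
    forall x, eclosed_ball xstar delta x -> phi x `<=` phi xstar].

(* Main.v *)
Require Import Defs.
From mathcomp Require Import ring lra.

(** Every operator [T_ i] with [i] in [phi xstar] fixes [xstar], because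
    [T xstar] is the singleton of [xstar]. A relaxed step with an averaged
    operator and a parameter between 0 and [alpha^-1] does not increase the
    distance to any of its fixed points (averaged_relaxation_fejer). As the starting point is at distance less than
    the radius of attraction from [xstar], all iterates stay at most that far,
    so that only indices in [phi xstar] are ever selected
    (attraction_radius_subset): the inclusion becomes an iteration of finitely
    many averaged operators, applied in an arbitrary order, with the common
    fixed point [xstar].

    Such an iteration converges (relaxed_averaged_cvg). The squared distances to
    [xstar] decrease by at least a fixed multiple of the squared residuals
    [|x n - T_ (s n) (x n)|^2] once [lambda n (alpha^-1 - lambda n)] is bounded
    away from 0, so the residuals tend to 0; and the iterates are bounded, so
    they have a cluster point [xbar] by compactness of balls
    (closed_ball0_compact). The operators that do not fix [xbar] are finitely
    many and have residuals bounded below near [xbar] (small_residual_fixed).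
    They are thus never used near [xbar] at late times, which makes the tail of
    the sequence Fejer monotone with respect to [xbar] and forces convergence
    to [xbar].

    Finally, outer semicontinuity makes the selected indices belong to
    [phi xbar] eventually (osc_near_subset), and the corresponding operators
    eventually fix [xbar], so [xbar] belongs to [T xbar]. *)

Set Implicit Arguments.
Unset Strict Implicit.
Unset Printing Implicit Defensive.

Local Open Scope classical_set_scope.
Local Open Scope ring_scope.

(** * Relaxed steps of averaged operators *)

(** This identity is all that the proof needs from the inner product. *)
Lemma normr_convex_combE (R : realType) (X : normedVectType R)
    (dot : {dot X for idfun}) (t : R) (u v : X) :
  hilbert_norm dot ->
  `|(1 - t) *: u + t *: v| ^+ 2 =
    (1 - t) * `|u| ^+ 2 + t * `|v| ^+ 2 - t * (1 - t) * `|u - v| ^+ 2.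
Proof.
move=> Hdot.
rewrite !Hdot !linearDl !linearDr !linearZl !linearZr /= !linearNl !linearNr /=.
have -> : dot v u = dot u v by rewrite hermitian_subproof /= expr0 mul1r.
ring.
Qed.

(** Expanding [|(1 - l) u + l v|^2] with [u = x - p] and [v = S x - p] leaves
    the residual with weight [l (1 - l)]; bounding [|v|^2] by averagedness adds
    [l (1 - alpha) / alpha], and the two weights add up to
    [l (alpha^-1 - l)]. *)
Lemma averaged_relaxation_descent (R : realType) (X : normedVectType R)
    (dot : {dot X for idfun}) (alpha l : R) (S : X -> X) (x p : X) :
  hilbert_norm dot -> averaged_nonexpansive alpha S -> S p = p -> 0 <= l ->
  `|(1 - l) *: x + l *: S x - p| ^+ 2 <=
    `|x - p| ^+ 2 - l * (alpha^-1 - l) * `|x - S x| ^+ 2.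
Proof.
move=> Hdot [a0 _ /(_ x p)] + Sp l0; rewrite Sp subrr subr0 => avg.
have -> : (1 - l) *: x + l *: S x - p = (1 - l) *: (x - p) + l *: (S x - p).
  by rewrite !scalerBr addrACA -opprD -scalerDl subrK scale1r.
rewrite (normr_convex_combE _ _ _ Hdot).
have -> : x - p - (S x - p) = x - S x by rewrite opprB addrA subrK.
have := ler_wpM2l l0 avg; rewrite -subr_ge0 => avgl.
rewrite -subr_ge0; apply: (le_trans avgl); rewrite le_eqVlt; apply/orP; left.
apply/eqP; field.
by rewrite gt_eqF.
Qed.

Lemma averaged_relaxation_fejer (R : realType) (X : normedVectType R)
    (dot : {dot X for idfun}) (alpha l : R) (S : X -> X) (x p : X) :
  hilbert_norm dot -> averaged_nonexpansive alpha S -> S p = p ->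
  0 <= l <= alpha^-1 -> `|(1 - l) *: x + l *: S x - p| <= `|x - p|.
Proof.
move=> Hdot avgS Sp /andP[l0 la]; rewrite -ler_sqr ?nnegrE//.
apply: le_trans (averaged_relaxation_descent x Hdot avgS Sp l0) _.
by rewrite gerBl !mulr_ge0 ?subr_ge0.
Qed.

Lemma averaged_nonexpansive_le (R : realType) (X : normedModType R)
    (alpha : R) (S : X -> X) (x y : X) :
  averaged_nonexpansive alpha S -> `|S x - S y| <= `|x - y|.
Proof.
move=> [a0 a1 /(_ x y) avg]; rewrite -ler_sqr ?nnegrE//.
apply: le_trans avg; rewrite lerDl mulr_ge0 ?divr_ge0 ?subr_ge0 ?sqr_ge0 ?ltW//.
Qed.

(** * Finite-dimensional compactness *)

(** Coordinates in a basis identify [X] with row vectors, whose bounded closed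
    sets are compact. The coordinate map [f] is continuous; its norm has a
    positive minimum [m] on the unit sphere, so [m |u| <= |f u|] and the ball of
    [X] is the image under [f] of a bounded closed set. *)
Lemma closed_ball0_compact (R : realType) (X : normedVectType R) (M : R) :
  compact [set x : X | `|x| <= M].
Proof.
pose f : 'rV[R]_(\dim {:X}) -> X := passmx.vecof (vbasis {:X}).
have e_basis := vbasisP {:X}.
have fZ a u : f (a *: u) = a *: f u.
  by rewrite /f /passmx.vecof scaler_sumr; apply: eq_bigr => j _;
    rewrite mxE scalerA.
have f_cont : continuous f.
  apply: continuous_big => [z|j _ u]; first exact: add_continuous.
  apply: (@cvgZr_tmp R X _ (nbhs u)); exact: (@coord_continuous R 1 _ 0 j u).
have nf_cont : continuous (fun u => `|f u|).
  by move=> u; apply: continuous_comp; [exact: f_cont|exact: norm_continuous].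
have [m m0 mf] : exists2 m : R, 0 < m & forall u, m * `|u| <= `|f u|.
  pose S := [set u : 'rV[R]_(\dim {:X}) | `|u| = 1].
  have normS u : u != 0 -> S (`|u|^-1 *: u).
    by move=> u0; rewrite /S /= normrZ normfV normr_id mulVf ?normr_eq0.
  (* The sphere is empty when [X] has dimension 0, and any [m > 0] will do. *)
  have [S0|/forallNP S0] := pselect (S !=set0); last first.
    exists 1 => // u; have [->|/normS/S0//] := eqVneq u 0.
    by rewrite normr0 mulr0.
  have Sc : compact S.
    apply: bounded_closed_compact.
      exists 1; split => // k k1 u /=; rewrite /S /= => ->; exact: ltW.
    have -> : S = (fun u => `|u|) @^-1` [set 1] by [].
    apply: preimage_closed; last exact: closed_eq.
    by move=> u _; exact: norm_continuous.
  have [u0 /set_mem Su0 fu0] :=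
    compact_EVT_min S0 Sc (continuous_subspaceT nf_cont).
  exists `|f u0|.
    rewrite normr_gt0 (passmx.vecof_eq0 e_basis) -normr_eq0.
    by move: Su0; rewrite /S /= => ->; rewrite oner_eq0.
  move=> u; have [->|un0] := eqVneq u 0; first by rewrite normr0 mulr0.
  rewrite -ler_pdivlMr ?normr_gt0//.
  apply: le_trans (fu0 _ (mem_set (normS _ un0))) _.
  by rewrite fZ normrZ normfV normr_id mulrC.
have -> : [set x : X | `|x| <= M] = f @` [set u | `|f u| <= M].
  rewrite eqEsubset; split => [x /= xM|_ [u uM <-]//].
  by exists (passmx.rVof (vbasis {:X}) x); rewrite /= /f passmx.rVofK.
apply: continuous_compact; first exact: continuous_subspaceT.
apply: bounded_closed_compact.
  exists (M / m); split => [|k k1 u /= uM]; first exact: num_real.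
  apply: le_trans (ltW k1); rewrite ler_pdivlMr// mulrC.
  exact: le_trans (mf u) uM.
have -> : [set u | `|f u| <= M] = (fun u => `|f u|) @^-1` [set t | t <= M] by [].
apply: preimage_closed; last exact: closed_le.
by move=> u _; exact: nf_cont.
Qed.

Lemma bounded_seq_cluster (R : realType) (X : normedVectType R) (M : R)
    (x : nat -> X) :
  (forall n, `|x n| <= M) ->
  exists xbar, forall e, 0 < e ->
    forall N, exists2 n, (N <= n)%N & `|x n - xbar| < e.
Proof.
move=> xM.
have [|xbar [_ xbar_cl]] := @closed_ball0_compact R X M (x @ \oo) _.
  by exists 0%N => // n _ /=; exact: xM.
exists xbar => e e0 N.
have [|_ [[n Nn <-]]] := xbar_cl (x @` [set n | (N <= n)%N]) (ball xbar e) _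
    (nbhsx_ballx _ _ e0).
  by exists N => // n Nn; exists n.
by rewrite -ball_normE /= distrC; exists n.
Qed.

(** * Balls inside the radius of attraction *)

(** A point at distance exactly [r] is not interior: pushing it slightly further
    away from [p], by [t (y - p)], leaves the ball while staying arbitrarily
    close. The push fails only for [y = p], whence the hypothesis [0 < r], which
    also covers a zero-dimensional space, where every set is open. *)
Lemma interior_eclosed_ball_lt (R : realType) (X : normedModType R) (p y : X)
    (r : \bar R) :
  (0 < r)%E -> interior (eclosed_ball p r) y -> (`|p - y|%:E < r)%E.
Proof.
move=> r0 yr; have [->|py] := eqVneq p y; first by rewrite subrr normr0.
have rho0 : 0 < `|p - y| by rewrite normr_gt0 subr_eq0.
have /nbhs_normP[e /= e0 ball_r] := yr.
pose t := e / 2 / `|p - y|.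
have t0 : 0 < t by rewrite !divr_gt0.
(* The displacement has norm [t * `|p - y| = e / 2 < e]. *)
have /ball_r : ball_ Num.norm y e (y + t *: (y - p)).
  rewrite /= opprD addNKr normrN normrZ gtr0_norm// distrC divfK ?gt_eqF//.
  by rewrite gtr_pMr// invf_lt1// ltr1n.
rewrite /eclosed_ball /=.
have -> : p - (y + t *: (y - p)) = (1 + t) *: (p - y).
  by rewrite scalerDl scale1r opprD addrA -scalerN opprB.
rewrite normrZ gtr0_norm ?addr_gt0//; apply: lt_le_trans.
by rewrite lte_fin ltr_pMl// ltrDl.
Qed.

(** The starting point lies strictly inside the ball of radius the supremum, so
    some admissible radius [d] already exceeds its distance to [p]. *)
Lemma attraction_radius_subset (R : realType) (X : normedModType R) (I : Type)
    (phi : X -> set I) (p x0 x : X) :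
  interior (eclosed_ball p (attraction_radius phi p)) x0 ->
  `|x - p| <= `|x0 - p| -> phi x `<=` phi p.
Proof.
move=> x0r xx0; have := interior_subset x0r; rewrite /eclosed_ball /= => x0r'.
have r0 : (0 < attraction_radius phi p)%E.
  (* The ball is nonempty, so the supremum is not [-oo]: some admissible radius
     exists, and admissible radii are positive. *)
  have /ereal_sup_gt[d [d0 dP] _] : (-oo < attraction_radius phi p)%E.
    exact: lt_le_trans (ltNyr _) x0r'.
  by apply: (lt_le_trans d0); exact: ereal_sup_ubound.
have /ereal_sup_gt[d [d0 dP] x0d] := interior_eclosed_ball_lt r0 x0r.
apply: dP; apply: le_trans (ltW x0d).
by rewrite lee_fin distrC [leRHS]distrC.
Qed.

(** * Convergence with a common fixed point *)

Lemma limn_einf_gt0 (R : realType) (u : nat -> R) :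
  (0 < limn_einf (fun n => (u n)%:E))%E ->
  exists2 c : R, 0 < c & \forall n \near \oo, c <= u n.
Proof.
rewrite limn_einf_lim (cvg_lim _ (@cvg_einfs_sup _ _))//.
move=> /ereal_sup_gt[_ [N _ <-]] /= l0.
have real_below (y : \bar R) : (0 < y)%E ->
    exists2 c : R, 0 < c & (c%:E <= y)%E.
  case: y => [r| |//]; first by rewrite lte_fin => r0; exists r.
  by move=> _; exists 1 => //; rewrite leey.
have [c c0 cl] := real_below _ l0.
exists c => //; exists N => // n /= Nn; rewrite -lee_fin.
by apply: (le_trans cl); apply: ereal_inf_lbound; exists n.
Qed.

(** A nonincreasing sequence bounded below converges, so its decrements vanish;
    here they dominate the squared residuals. *)
Lemma descent_residual_small (R : realType) (a rho : nat -> R) (c e : R) :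
  0 < c -> 0 < e -> (forall n, 0 <= a n) -> (forall n, a n.+1 <= a n) ->
  (\forall n \near \oo, c * rho n ^+ 2 <= a n - a n.+1) ->
  \forall n \near \oo, rho n < e.
Proof.
move=> c0 e0 a0 a_dec rho_le.
have a_cvg : cvgn a.
  apply: nonincreasing_is_cvgn; first exact/nonincreasing_seqP.
  by exists 0 => _ [n _ <-].
have da_cvg : a n - a n.+1 @[n --> \oo] --> (0 : R).
  rewrite -(subrr (limn a)); apply: cvgB => //.
  by rewrite (cvg_shiftS a).
have ce0 : 0 < c * e ^+ 2 by rewrite mulr_gt0 ?exprn_gt0.
have da_lt := cvgr_lt _ da_cvg _ ce0.
near=> n.
have rho_n : c * rho n ^+ 2 < c * e ^+ 2.
  apply: (@le_lt_trans _ _ (a n - a n.+1)); near: n; last exact: da_lt.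
  exact: rho_le.
rewrite ltNge; apply: contraTN rho_n => e_le; rewrite -leNgt ler_pM2l//.
by rewrite ler_sqr ?nnegrE ?(ltW e0)// (le_trans (ltW e0)).
Unshelve. all: by end_near. Qed.

(** The finitely many operators that move [p] move it by a distance bounded
    below. If [y] is close to [p] and [T_ i] hardly moves [y], then [T_ i] hardly
    moves [p], by nonexpansiveness, so it does not move [p] at all. *)
Lemma small_residual_fixed (R : realType) (X : normedModType R) (alpha : R)
    (I : finType) (T_ : I -> X -> X) (p : X) :
  (forall i, averaged_nonexpansive alpha (T_ i)) ->
  exists2 e : R, 0 < e &
    forall i y, `|y - p| < e -> `|y - T_ i y| < e -> T_ i p = p.
Proof.
move=> avg.
have : \forall e \near (0:R)^'+, forall i, T_ i p != p -> e < `|p - T_ i p| / 3.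
  apply: filter_forall => i; have [->|Tip] := eqVneq (T_ i p) p; first by near=> e.
  near=> e => _; near: e; apply: nbhs_right_lt.
  by rewrite divr_gt0// normr_gt0 subr_eq0 eq_sym.
move=> sep.
have [e [e0 esep]] : exists e : R,
    0 < e /\ forall i, T_ i p != p -> e < `|p - T_ i p| / 3.
  apply: (@filter_ex _ (0:R)^'+); apply: filterI sep; exact: nbhs_right_gt.
(* [|p - T_ i p| <= |p - y| + |y - T_ i y| + |T_ i y - T_ i p|], and each of
   the three terms is less than [e]; hence the factor 3. *)
exists e => // i y yp yT; apply/eqP; apply: contraT => /esep.
have := averaged_nonexpansive_le y p (avg i).
have := ler_normD (p - y) (y - T_ i y + (T_ i y - T_ i p)).
have := ler_normD (y - T_ i y) (T_ i y - T_ i p).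
have -> : p - y + (y - T_ i y + (T_ i y - T_ i p)) = p - T_ i p.
  by rewrite !addrA !subrK.
rewrite (distrC p y); lra.
Unshelve. all: by end_near. Qed.

(** The operators may be applied in any order, and no cluster point [xbar] is
    known beforehand to be a common fixed point. However, once an iterate with
    small residuals from then on comes close to [xbar], the operator applied
    there fixes [xbar], so the next iterate is no farther from [xbar], and the
    argument repeats: from some index on the sequence is Fejer monotone with
    respect to its own cluster point, hence converges to it. *)
Lemma relaxed_averaged_cvg (R : realType) (X : normedVectType R)
    (dot : {dot X for idfun}) (alpha c : R) (I : finType) (T_ : I -> X -> X)
    (lambda : nat -> R) (s : nat -> I) (x : nat -> X) (p : X) :
  hilbert_norm dot -> (forall i, averaged_nonexpansive alpha (T_ i)) ->
  (forall n, 0 < lambda n <= alpha^-1) ->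
  0 < c -> (\forall n \near \oo, c <= lambda n * (alpha^-1 - lambda n)) ->
  (forall n, x n.+1 = (1 - lambda n) *: x n + lambda n *: T_ (s n) (x n)) ->
  (forall n, T_ (s n) p = p) ->
  exists2 xbar, x @ \oo --> xbar & \forall n \near \oo, T_ (s n) xbar = xbar.
Proof.
move=> Hdot avg lambdaP c0 lambda_c xS Tp.
have fejer n q : T_ (s n) q = q -> `|x n.+1 - q| <= `|x n - q|.
  move=> Tq; rewrite xS; apply: averaged_relaxation_fejer Hdot (avg _) Tq _.
  by have /andP[/ltW -> ->] := lambdaP n.
have x_bounded n : `|x n| <= `|x 0%N - p| + `|p|.
  rewrite -{1}[x n](subrK p); apply: le_trans (ler_normD _ _) _.
  rewrite lerD2r; elim: n => // n; apply: le_trans.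
  exact: fejer.
have residual e : 0 < e -> \forall n \near \oo, `|x n - T_ (s n) (x n)| < e.
  move=> e0; apply: (@descent_residual_small _ (fun n => `|x n - p| ^+ 2) _ c) => //.
    by move=> n; rewrite ler_sqr ?nnegrE// fejer.
  near=> n; rewrite lerBrDr -lerBrDl xS.
  have /andP[/ltW l0 _] := lambdaP n.
  apply: le_trans (averaged_relaxation_descent (x n) Hdot (avg (s n)) (Tp n) l0) _.
  rewrite lerD2l lerN2 ler_wpM2r ?sqr_ge0//.
  by near: n; exact: lambda_c.
have [xbar xbar_cl] := bounded_seq_cluster x_bounded.
have [e e0 e_fix] := small_residual_fixed xbar avg.
have [N _ Nres] := residual e e0.
have [m Nm xm] := xbar_cl e e0 N.
(* The iterates cannot leave the ball of radius [e] around [xbar] after [m]. *)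
have xe n : (m <= n)%N -> `|x n - xbar| < e.
  elim: n => [|n IHn]; first by rewrite leqn0 => /eqP <-.
  rewrite leq_eqVlt => /predU1P[<-//|]; rewrite ltnS => mn.
  apply: le_lt_trans (IHn mn); apply: fejer.
  by apply: e_fix (IHn mn) _; apply: Nres; exact: leq_trans Nm mn.
have fix_xbar n : (m <= n)%N -> T_ (s n) xbar = xbar.
  by move=> mn; apply: e_fix (xe n mn) _; apply: Nres; exact: leq_trans Nm mn.
exists xbar; last by exists m.
apply/cvgrPdist_lt => d d0; have [k mk xk] := xbar_cl d d0 m.
exists k => // n /= kn; rewrite distrC; apply: le_lt_trans xk.
elim: n kn => [|n IHn]; first by rewrite leqn0 => /eqP ->.
rewrite leq_eqVlt => /predU1P[<-//|]; rewrite ltnS => kn.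
by apply: le_trans (IHn kn); apply/fejer/fix_xbar; exact: leq_trans mk kn.
Unshelve. all: by end_near. Qed.

(** * The union averaged operator *)

(** An index outside [phi xbar] cannot be active along a subsequence of [x], by
    outer semicontinuity applied to a constant sequence of indices; as there are
    finitely many indices, one threshold serves all of them. *)
Lemma osc_near_subset (R : realType) (X : normedModType R) (I : finType)
    (phi : X -> set I) (x : nat -> X) (xbar : X) :
  @outer_semicontinuous X (discrete_topology I) phi -> x @ \oo --> xbar ->
  \forall n \near \oo, phi (x n) `<=` phi xbar.
Proof.
move=> osc xcvg.
suff : \forall n \near \oo, forall i, phi (x n) i -> phi xbar i by [].
apply: filter_forall => i.
have [xi|xi] := pselect (phi xbar i); first by near=> n.
have [[N xN]|/forallNP xN] :=
    pselect (exists N, forall n, (N <= n)%N -> ~ phi (x n) i).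
  by exists N => // n Nn /(xN _ Nn).
have {}xN N : exists n, (N <= n)%N /\ phi (x n) i.
  have /existsNP[n /not_implyP[Nn /contrapT]] := xN N.
  by exists n.
have [k kP] := choice xN.
exfalso; apply: xi.
apply: (osc (x \o k) (fun=> i)) => [||n].
- apply: cvg_comp xcvg => A [N _ NA].
  by exists N => // n Nn; apply: NA; exact: leq_trans Nn (kP n).1.
- exact: cvg_cst.
- exact: (kP n).2.
Unshelve. all: by end_near. Qed.

Theorem corollary4p2 (R : realType) (X : normedVectType R)
    (dot : {dot X for idfun}) (Hdot : hilbert_norm dot)
    (alpha : R) (alpha_gt0 : 0 < alpha) (alpha_lt1 : alpha < 1)
    (T : X -> set X) (I : finType) (T_ : I -> X -> X) (phi : X -> set I)
    (HT : union_averaged_repr alpha T T_ phi)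
    (xstar : X) (Hxstar : strong_Fix T xstar)
    (lambda : nat -> R)
    (Hlambda : forall n, 0 < lambda n <= alpha^-1)
    (Hliminf : (0 < limn_einf (fun n =>
                      (lambda n * (alpha^-1 - lambda n))%:E))%E)
    (x : nat -> X)
    (Hx0 : (interior (eclosed_ball xstar (attraction_radius phi xstar))) (x 0%N))
    (Hx : forall n, [set (1 - lambda n) *: x n + lambda n *: y | y in T (x n)]
                      (x n.+1)) :
  exists xbar : X,
    (Fix T `&` eclosed_ball xstar (attraction_radius phi xstar)) xbar /\
    x @ \oo --> xbar.
Proof.
have [avg osc _ TE] := HT.
have phi_fix i : phi xstar i -> T_ i xstar = xstar.
  move=> phi_i; have : T xstar (T_ i xstar) by rewrite TE; exists i.
  by rewrite Hxstar.
have step n : exists i, phi (x n) i /\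
    x n.+1 = (1 - lambda n) *: x n + lambda n *: T_ i (x n).
  by have [y + <-] := Hx n; rewrite TE => -[i phi_i <-]; exists i.
have [s sP] := choice step.
have x_ball n : `|x n - xstar| <= `|x 0%N - xstar|.
  elim: n => // n IHn; rewrite (sP n).2; apply: (le_trans _ IHn).
  apply: averaged_relaxation_fejer Hdot (avg _) _ _.
    by apply: phi_fix; apply: attraction_radius_subset Hx0 IHn _ (sP n).1.
  by have /andP[/ltW -> ->] := Hlambda n.
have s_fix n : T_ (s n) xstar = xstar.
  by apply: phi_fix; apply: attraction_radius_subset Hx0 (x_ball n) _ (sP n).1.
have [c c0 lambda_c] := limn_einf_gt0 Hliminf.
have [xbar x_cvg xbar_fix] := relaxed_averaged_cvg Hdot avg Hlambda c0 lambda_c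
  (fun n => (sP n).2) s_fix.
exists xbar; split=> //; split.
  have [n [phi_n Tn]] : exists n, phi (x n) `<=` phi xbar /\ T_ (s n) xbar = xbar.
    apply: (@filter_ex _ \oo); apply: filterI xbar_fix.
    exact: osc_near_subset osc x_cvg.
  by rewrite /Fix /= TE; exists (s n) => //; exact: phi_n (sP n).1.
apply: le_trans (interior_subset Hx0); rewrite lee_fin.
have norm_cvg : `|xstar - x n| @[n --> \oo] --> `|xstar - xbar|.
  by apply: cvg_norm; apply: cvgB => //; exact: cvg_cst.
apply: (closed_cvg (fun t => t <= `|xstar - x 0%N|) (@closed_le _ _) _ _ norm_cvg).
by near=> n; rewrite /= distrC [leRHS]distrC.
Unshelve. all: by end_near. Qed.
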